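(* Let $\lambda>0$, let $Z_\lambda$ be a Poisson random variable of parameter $\lambda$, and set $\hat Z_\lambda=\dfrac{Z_\lambda-\lambda}{\sqrt{\lambda}}$. Let $\mathbf P$ denote the standard Gaussian measure $\mathcal N(0,1)$ on $\mathbf R$. Then $$\sup_{F\in\mathcal C^2_b,\ \|F\|_{\mathcal C^2_b}\le 1}\left|\mathbf E\left[F(\hat Z_\lambda)\right]-\int_{\mathbf R}F\,d\mathbf P\right|\le \frac{\sqrt{\pi}}{4\sqrt{2}}\,\frac{1}{\sqrt{\lambda}}.$$
   Context: $\mathcal C^2_b$ is the space of twice continuously differentiable functions $F:\mathbf R\to\mathbf R$ such that $F$, $F'$ and $F''$ are bounded, with the usual norm $\|F\|_{\mathcal C^2_b}=\|F\|_\infty+\|F'\|_\infty+\|F''\|_\infty$. *)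

(* Defs.v *)
From HB Require Import structures.
From mathcomp Require Import all_boot all_order all_algebra.
From mathcomp Require Import all_classical all_reals all_analysis.

Set Implicit Arguments.
Unset Strict Implicit.
Unset Printing Implicit Defensive.

Import Order.TTheory GRing.Theory Num.Theory.
Import numFieldNormedType.Exports.

Local Open Scope classical_set_scope.
Local Open Scope ring_scope.

(* The library's [poisson_prob] takes a dummy [nat] argument, which its body
   does not use; any value gives the same measure. *)
Definition is_poisson (d : measure_display) (T : measurableType d)
    (R : realType) (P : probability T R) (lambda : R) (Z : {RV P >-> nat}) :=
  forall A : set nat, distribution P Z A = poisson_prob lambda 0%N A.

(* The supremum is taken in [\bar R], hence is +oo if [f] is unbounded. *)
Definition sup_norm (R : realType) (f : R -> R) : \bar R :=
  ereal_sup [set `|f x|%:E | x in [set: R]].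

(* [derive1] is a total operator, so that differentiability is required
   separately. *)
Definition C2b (R : realType) (F : R -> R) : Prop :=
  [/\ forall x, derivable F x 1,
      forall x, derivable F^`()%classic x 1,
      continuous F^`(2)%classic &
      [/\ bounded_fun F, bounded_fun F^`()%classic & bounded_fun F^`(2)%classic] ].

Definition C2b_norm (R : realType) (F : R -> R) : \bar R :=
  (sup_norm F + sup_norm F^`()%classic + sup_norm F^`(2)%classic)%E.

(* Main.v *)
Require Import Defs.
From mathcomp Require Import all_boot all_order all_algebra.
From mathcomp Require Import all_classical all_reals all_analysis.
From mathcomp Require Import ring lra measurable_realfun.

Import Order.TTheory GRing.Theory Num.Theory.
Import numFieldNormedType.Exports.

Local Open Scope classical_set_scope.
Local Open Scope ring_scope.

(* Rotate [Z^] into an independent standard Gaussian [N]: with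
   [phi t = E (F (cos t * Z^ + sin t * N))], the two integrals to compare are
   [phi 0] and [phi (pi / 2)].  Write [h = 1 / sqrt lambda].  The Chen-Stein
   identity [E (Z^ A(Z^)) = (E A(Z^ + h) - E A(Z^)) / h] for the Poisson
   variable and Gaussian integration by parts (used to trade [sin t * E F']
   for [E (N F)]) turn [phi' t] into
   [- E (N (F (u + h cos t) - F u - h cos t * F' u)) / h] with
   [u = cos t * Z^ + sin t * N].  By Taylor,
   [|phi' t| <= (h / 2) (cos t)^2 |F''|_oo E |N|], and the constant comes from
   [E |N| = sqrt (2 / pi)] and the integral [pi / 4] of [(cos t)^2] over
   [0, pi / 2]. *)

(** * Bounded functions and their integrals against a probability measure *)

Lemma le_bounded_fun (R : realType) (T : Type) (f : T -> R) (M : R) :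
  (forall x, `|f x| <= M) -> bounded_fun f.
Proof.
move=> fM; exists M; split; first exact: num_real.
by move=> x Mx y _ /=; apply: le_trans (fM y) _; exact: ltW.
Qed.

Lemma is_derive_continuous (R : realType) (f f1 : R -> R) :
  (forall x : R, is_derive x 1 f (f1 x)) -> continuous f.
Proof.
move=> df x; apply: differentiable_continuous.
by apply/derivable1_diffP; case: (df x).
Qed.

Section probability_integrals.
Context {R : realType} d {T : measurableType d} (P : probability T R).

Lemma integrable_bounded_probability (f : T -> R) (M : R) :
    measurable_fun [set: T] f -> (forall x, `|f x| <= M) ->
  P.-integrable setT (EFin \o f).
Proof.
move=> mf fM; apply: measurable_bounded_integrable => //.
  by rewrite (le_lt_trans (probability_le1 _ _)) ?ltry.
exact: le_bounded_fun fM.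
Qed.

Lemma Rintegral_probability_cst (r : R) : \int[P]_x r = r.
Proof.
rewrite Rintegral_cst// [fine _](_ : _ = 1) ?mulr1//.
exact: (congr1 fine (@probability_setT _ _ _ P)).
Qed.

Lemma Rintegral_probability_le (f : T -> R) (N : R) :
    P.-integrable setT (EFin \o f) -> (forall x, `|f x| <= N) ->
  `|\int[P]_x f x| <= N.
Proof.
move=> fi fN; apply: le_trans (le_normr_Rintegral _ fi) _ => //.
rewrite -[leRHS]Rintegral_probability_cst; apply: le_Rintegral => //.
  exact: integrable_abse fi.
exact: finite_measure_integrable_cst.
Qed.

End probability_integrals.

(** * The standard Gaussian: density, first absolute moment, integration by parts *)

Section gaussian.
Context {R : realType}.
Local Notation mu := (@lebesgue_measure R).
Local Notation gauss := (normal_prob (0 : R) 1).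
Local Notation phi := (normal_pdf (0 : R) 1).

(** [phi] and the Radon-Nikodym derivative of [gauss] with respect to [mu] have the same integral
    over every measurable set, hence agree almost everywhere, so the change of variables can be read
    with [phi]. *)
Lemma ge0_integral_normal_prob (f : R -> \bar R) :
  measurable_fun [set: R] f -> (forall x, 0 <= f x)%E ->
  (\int[gauss]_x f x = \int[mu]_x (f x * (phi x)%:E))%E.
Proof.
move=> mf f0.
have gmu := normal_prob_dominates (0 : R) (1 : R).
rewrite -(Radon_Nikodym_SigmaFinite.change_of_variables gmu)//=.
have irn := Radon_Nikodym_SigmaFinite.f_integrable gmu.
have mphi : measurable_fun [set: R] (fun x => (phi x)%:E).
  by apply/measurable_EFinP; exact: measurable_normal_pdf.
apply: ae_eq_integral => //.
- by apply: emeasurable_funM => //; exact: (measurable_int _ irn).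
- exact: emeasurable_funM.
- apply: ae_eqe_mul2l; apply: integral_ae_eq => //.
  by move=> E _ mE; rewrite -Radon_Nikodym_SigmaFinite.f_integral.
Qed.

(** Since [phi] is nonnegative, multiplying by it commutes with taking positive and negative parts,
    and the nonnegative case applies to each part. *)
Lemma integral_normal_prob (f : R -> R) : measurable_fun [set: R] f ->
  (\int[gauss]_x (f x)%:E = \int[mu]_x (f x * phi x)%:E)%E.
Proof.
move=> mf; have phi0 x : (0 <= phi x)%R by exact: normal_pdf_ge0.
rewrite integralE [RHS]integralE.
rewrite !ge0_integral_normal_prob//; last 2 first.
- by apply: measurable_funeneg; exact/measurable_EFinP.
- by apply: measurable_funepos; exact/measurable_EFinP.
have phiM (y : \bar R) (p : R) : (0 <= p)%R ->
    (maxe y 0 * p%:E = maxe (y * p%:E) 0)%E.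
  by move=> p0; rewrite muleC maxe_pMr ?lee_fin// mule0 muleC.
congr (_ - _)%E; apply: eq_integral => x _.
  by rewrite !funeposE phiM.
rewrite !funenegE phiM//.
by rewrite EFinM mulNe.
Qed.

Lemma normal_pdf01E (x : R) :
  phi x = (Num.sqrt (pi *+ 2))^-1 * expR (- (x ^+ 2 / 2)).
Proof.
rewrite /normal_pdf oner_eq0 /normal_peak /normal_fun.
by rewrite expr1n mul1r subr0 mulNr mulrC.
Qed.

Lemma is_derive_normal_pdf01 (x : R) : is_derive x 1 phi (- (x * phi x)).
Proof.
have -> : phi = (Num.sqrt (pi *+ 2))^-1 \*:
    (expR \o (fun x : R => - (2^-1 *: x ^+ 2))).
  by apply/funext => y; rewrite normal_pdf01E fctE /= [2^-1 *: _]mulrC.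
apply: is_derive_eq.
rewrite [in RHS]fctE /= /GRing.scale/=; move: (_^-1) => c.
by field.
Qed.

Lemma normal_pdf01N (x : R) : phi (- x) = phi x.
Proof. by rewrite !normal_pdf01E sqrrN. Qed.

Lemma cvgy_normal_pdf01 : phi x @[x --> +oo%R] --> 0.
Proof.
set c : R := (Num.sqrt (pi *+ 2))^-1.
have cexp : c * expR (- x) @[x --> +oo%R] --> 0.
  rewrite -[X in _ --> X](mulr0 c).
  by apply: cvgM; [exact: cvg_cst|exact: cvgr_expR].
apply: (@squeeze_cvgr _ _ _ _ (cst 0) (fun x => c * expR (- x))) => //;
  last exact: cvg_cst.
near=> x; rewrite normal_pdf_ge0/= normal_pdf01E -/c ler_wpM2l ?invr_ge0//.
rewrite ler_expR lerN2.
(* From 2 on, [x <= x ^+ 2 / 2], so the density lies below [c * expR (- x)]. *)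
have x2 : 2 <= x by near: x; exact: nbhs_pinfty_ge.
nra.
Unshelve. all: by end_near. Qed.

Lemma continuous_normal_pdf01 : continuous phi.
Proof. by apply: continuous_normal_pdf; rewrite oner_eq0. Qed.

(** The integrand is even and [- phi] is an antiderivative of [x * phi x] on the positive half-line,
    so the value is [2 * phi 0 = 2 / sqrt (2 pi)]. *)
Lemma integral_normr_normal_prob :
  (\int[gauss]_x `|x|%:E = (Num.sqrt (2 / pi))%:E)%E.
Proof.
rewrite ge0_integral_normal_prob//; last first.
  by apply/measurable_EFinP; exact: normr_measurable.
pose f (x : R) := `|x| * phi x.
transitivity (\int[mu]_x (f x)%:E)%E; first exact: eq_integral.
have f0 x : 0 <= f x by rewrite mulr_ge0// normal_pdf_ge0.
have cf : continuous f.
  move=> x; apply: continuousM; first exact: norm_continuous.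
  exact: continuous_normal_pdf01.
rewrite ge0_symfun_integralT//; last first.
  by move=> x; rewrite /f/= normrN normal_pdf01N.
rewrite -set_itvcy (@ge0_continuous_FTC2y _ _ (\- phi) _ 0)//.
- rewrite -EFinB -EFinM /= sub0r opprK normal_pdf01E expr0n/= mul0r oppr0.
  rewrite expR0 mulr1.
  set s := Num.sqrt (pi *+ 2); congr EFin.
  have s2 : s ^+ 2 = pi *+ 2 by rewrite sqr_sqrtr// mulrn_wge0// pi_ge0.
  have -> : 2 / pi = (2 / s) ^+ 2 :> R.
    rewrite exprMn exprVn s2 -[pi *+ 2]mulr_natl.
    have : (pi : R) != 0 by rewrite gt_eqF// pi_gt0.
    by move: (pi : R) => p p0; field.
  by rewrite sqrtr_sqr ger0_norm// divr_ge0// sqrtr_ge0.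
- exact: continuous_subspaceT.
- by rewrite -[X in _ --> X]oppr0; apply: cvgN; exact: cvgy_normal_pdf01.
- by move=> x _; apply: derivableN; case: (is_derive_normal_pdf01 x).
- by apply: cvgN; apply: cvg_at_right_filter; exact: continuous_normal_pdf01.
- move=> x; rewrite in_itv/= andbT => x0.
  have dphi := is_derive_normal_pdf01 x.
  by rewrite derive1E deriveN// derive_val opprK /f gtr0_norm.
Qed.

Lemma integrable_id_normal_prob : gauss.-integrable setT (fun x : R => x%:E).
Proof.
apply/integrableP; split; first exact/measurable_EFinP.
by under eq_integral do rewrite abse_EFin;
  rewrite integral_normr_normal_prob ltry.
Qed.

Lemma integrable_bounded_normal_prob (f : R -> R) (M : R) :
    continuous f -> (forall x, `|f x| <= M) ->
  gauss.-integrable setT (EFin \o f).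
Proof.
move=> cf fM; apply: measurable_bounded_integrable => //.
- by rewrite (le_lt_trans (probability_le1 _ _)) ?ltry.
- exact: continuous_measurable_fun.
- exact: le_bounded_fun fM.
Qed.

Lemma integrableM_id_normal_prob (f : R -> R) (M : R) :
    continuous f -> (forall x, `|f x| <= M) ->
  gauss.-integrable setT (fun x => (x * f x)%:E).
Proof.
move=> cf fM.
apply: (integrableMl measurableT integrable_id_normal_prob).
- exact: continuous_measurable_fun.
- exact: le_bounded_fun fM.
Qed.

(** [(x * G x - g x) * phi x] is the derivative of [- (G x * phi x)], which tends to 0 at both ends
    because [G] is bounded; its integral over the line is therefore 0. *)
Lemma integral_normal_prob_by_parts (G g : R -> R) (M : R) :
    (forall x : R, is_derive x 1 G (g x)) -> continuous g ->
    (forall x, `|G x| <= M) -> (forall x, `|g x| <= M) ->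
  \int[gauss]_x (x * G x) = \int[gauss]_x g x.
Proof.
move=> dG cg GM gM.
have cG : continuous G := is_derive_continuous _ _ _ dG.
have iG := integrableM_id_normal_prob _ _ cG GM.
have ig := integrable_bounded_normal_prob _ _ cg gM.
have mxG : measurable_fun [set: R] (fun x => x * G x).
  by move/measurable_int : iG => /measurable_EFinP.
have mg : measurable_fun [set: R] g by exact: continuous_measurable_fun.
apply/eqP; rewrite -subr_eq0; apply/eqP.
rewrite -RintegralB//.
pose h (x : R) := x * G x - g x.
have ih : gauss.-integrable setT (EFin \o h).
  rewrite /h; under [EFin \o _]eq_fun do rewrite /= EFinB. exact: integrableB.
have mh : measurable_fun [set: R] h by exact: measurable_funB.
rewrite /Rintegral integral_normal_prob// -/h.
have mhphi : measurable_fun [set: R] (fun x => h x * phi x).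
  by apply: measurable_funM => //; exact: measurable_normal_pdf.
have imh : mu.-integrable setT (fun x => (h x * phi x)%:E).
  apply/integrableP; split.
    exact/measurable_EFinP.
  move/integrableP : ih => [_]; rewrite ge0_integral_normal_prob//; last first.
    by do 2 apply: measurableT_comp => //.
  congr (_ < _)%E; apply: eq_integral => x _ /=.
  by rewrite normrM (ger0_norm (normal_pdf_ge0 _ _ _)) EFinM.
pose H (x : R) := - (G x * phi x).
have dH (x : R) : is_derive x 1 H (h x * phi x).
  have d1 := dG x; have d2 := is_derive_normal_pdf01 x.
  apply: is_derive_eq; rewrite /h /GRing.scale/=; ring.
have ch : continuous (fun x => h x * phi x).
  move=> x; apply: continuousM; last exact: continuous_normal_pdf01.
  by apply: continuousB; [apply: continuousM => //; exact: cG|exact: cg].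
(* Truncation to [[- n, n]]: the fundamental theorem of calculus computes the integral of [hn n],
   and dominated convergence identifies the limit with the full integral. *)
pose hn n : R -> R := (fun x => h x * phi x) \_ `[- n%:R, n%:R].
have mhn n : measurable_fun [set: R] (hn n).
  apply: (proj1 (measurable_restrictT _ _)) => //.
  exact: measurable_funTS mhphi.
have fin0 : (\int[mu]_x (hn n x)%:E)%E @[n --> \oo] --> 0%E.
  (* [phi] is even, so both boundary terms carry the same factor [phi n], with coefficients at most
     [M] in absolute value. *)
  have HN (n : nat) : `|H n%:R - H (- n%:R)| <= 2 * M * phi n%:R.
    rewrite /H opprK normal_pdf01N -mulNr -mulrDl normrM.
    rewrite (ger0_norm (normal_pdf_ge0 _ _ _)) ler_wpM2r ?normal_pdf_ge0//.
    rewrite (le_trans (ler_normD _ _))// normrN.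
    by have := GM n%:R; have := GM (- n%:R); lra.
  have H0 : (H n%:R - H (- n%:R)) @[n --> \oo] --> (0 : R).
    have cphi : 2 * M * phi n%:R @[n --> \oo] --> (0 : R).
      rewrite -[X in _ --> X](mulr0 (2 * M)); apply: cvgMl_tmp.
      exact: (cvg_comp _ _ (@cvgr_idn R) cvgy_normal_pdf01).
    apply: norm_cvg0.
    apply: (@squeeze_cvgr _ _ _ _ (cst 0) _ _ _ _ _ cphi) => //.
      by near=> n; rewrite normr_ge0/= HN.
    exact: cvg_cst.
  have H0E : (H n%:R - H (- n%:R))%:E @[n --> \oo] --> 0%E.
    by apply: cvg_EFin; [exact: nearW|exact: H0].
  apply: cvg_trans H0E.
  apply: near_eq_cvg; near=> n; rewrite /=.
  (* At [n = 0] the interval degenerates; the fundamental theorem is applied where [- n < n]. *)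
  have n0 : (0 < n)%N by near: n; exact: nbhs_infty_gt.
  transitivity (\int[mu]_(x in `[(- n%:R)%R, n%:R]) (h x * phi x)%:E)%E.
    apply/esym; rewrite EFinB; apply: continuous_FTC2.
    - by rewrite gtrN// ltr0n.
    - exact: continuous_subspaceT.
    - split.
      + by move=> x _; case: (dH x).
      + by apply: cvg_at_right_filter; exact: is_derive_continuous dH _.
      + by apply: cvg_at_left_filter; exact: is_derive_continuous dH _.
    - by move=> x _; rewrite derive1E; exact: derive_val.
  by rewrite integral_mkcond; apply: eq_integral => x _; rewrite restrict_EFin.
have : (\int[mu]_x (hn n x)%:E)%E @[n --> \oo] -->
    (\int[mu]_x (h x * phi x)%:E)%E.
  apply: (@dominated_cvg _ _ _ mu _ measurableT _ _
    (fun x => `|h x * phi x|%:E)) => //.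
  - by move=> n; apply/measurable_EFinP; exact: mhn.
  - move=> x _; apply: cvg_near_cst; near=> n.
    rewrite /hn patchE mem_set//= in_itv/= -ler_norml.
    by near: n; exact: nbhs_infty_ger.
  - exact: integrable_abse imh.
  - move=> n x _; rewrite /hn patchE lee_fin; case: ifPn => // _.
    by rewrite normr0.
by move/(cvg_unique _ fin0) => /= <-.
Unshelve. all: by end_near. Qed.
(** The factor [sqrt (2 / pi)] is the first absolute moment of the Gaussian. *)
Lemma normal_prob_moment_le (f : R -> R) (N : R) :
    continuous f -> (forall x, `|f x| <= N) ->
  `|\int[gauss]_y (y * f y)| <= N * Num.sqrt (2 / pi).
Proof.
move=> cf fN; have yf := integrableM_id_normal_prob _ _ cf fN.
apply: le_trans (le_normr_Rintegral _ yf) _ => //.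
have iy : gauss.-integrable setT (EFin \o (fun y : R => `|y|)).
  exact: integrable_abse integrable_id_normal_prob.
have : \int[gauss]_y `|y * f y| <= \int[gauss]_y (N * `|y|).
  apply: le_Rintegral => //; first exact: integrable_abse yf.
    exact: (integrableZl measurableT _ iy).
  by move=> y _; rewrite normrM mulrC ler_wpM2r.
by rewrite RintegralZl// /Rintegral integral_normr_normal_prob.
Qed.

End gaussian.

(** * The Poisson distribution and its Stein identity *)

Section poisson.
Context {R : realType} (lambda : R) (lambda_gt0 : 0 < lambda).
Local Notation pois := (poisson_prob lambda 0).

Lemma poisson_pmfS (k : nat) :
  k.+1%:R * poisson_pmf lambda k.+1 = lambda * poisson_pmf lambda k.
Proof.
rewrite /poisson_pmf lambda_gt0 factS natrM exprS.
have : k.+1%:R != 0 :> R by rewrite pnatr_eq0.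
have : k`!%:R != 0 :> R by rewrite pnatr_eq0 -lt0n fact_gt0.
move: (k.+1%:R : R) (k`!%:R : R) => a b b0 a0.
by field; rewrite b0 a0.
Qed.

(** The singletons partition [nat], and the integrand is constant on each of them. *)
Lemma ge0_integral_poisson_prob (f : nat -> R) : (forall k, 0 <= f k) ->
  (\int[pois]_k (f k)%:E = \sum_(k <oo) (f k * poisson_pmf lambda k)%:E)%E.
Proof.
move=> f0.
have -> : [set: nat] = \bigcup_k [set k].
  by apply/seteqP; split => // k _; exists k.
rewrite ge0_integral_bigcup//; last 2 first.
- by move=> k _; rewrite lee_fin.
- by move=> i j _ _ [k []] /= -> ->.
apply: eq_eseriesr => k _.
rewrite (eq_integral (cst (f k)%:E)); last by move=> j; rewrite inE/= => ->.
rewrite integral_cst//= EFinM.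
have -> : poisson_prob lambda 0 [set k] = (poisson_pmf lambda k)%:E.
  by rewrite /poisson_prob lambda_gt0 esum_set1// lee_fin poisson_pmf_ge0.
by [].
Qed.

(** The term at [k = 0] vanishes, and after an index shift [poisson_pmfS] trades the factor [k.+1]
    for [lambda]. Nonnegativity makes both sides meaningful in [\bar R] before the mean is known to
    be finite. *)
Lemma ge0_poisson_prob_stein (f : nat -> R) : (forall k, 0 <= f k) ->
  (\int[pois]_k (k%:R * f k)%:E = lambda%:E * \int[pois]_k (f k.+1)%:E)%E.
Proof.
move=> f0.
have fp k : 0 <= f k.+1 * poisson_pmf lambda k.
  by rewrite mulr_ge0 ?poisson_pmf_ge0.
rewrite !ge0_integral_poisson_prob//; last by move=> k; rewrite mulr_ge0.
rewrite nneseries_recl//; last first.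
  by move=> k _; rewrite lee_fin !mulr_ge0 ?poisson_pmf_ge0.
rewrite mul0r mul0r add0e -nneseries_addn; last first.
  by move=> k; rewrite lee_fin !mulr_ge0 ?poisson_pmf_ge0.
rewrite -nneseriesZl; last by move=> k _; rewrite lee_fin.
apply: eq_eseriesr => k _; rewrite addn1 -EFinM; congr EFin.
by rewrite mulrAC poisson_pmfS; ring.
Qed.

Lemma integrable_bounded_poisson_prob (f : nat -> R) (M : R) :
  (forall x, `|f x| <= M) -> pois.-integrable setT (EFin \o f).
Proof. exact: integrable_bounded_probability. Qed.

Lemma integrable_id_poisson_prob :
  pois.-integrable setT (fun k => (k%:R : R)%:E).
Proof.
apply/integrableP; split => //.
(* The Stein identity for the constant function 1 gives the mean as [lambda] times the total
   mass. *)
rewrite (eq_integral (fun k => (k%:R * cst 1 k)%:E)); last first.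
  by move=> k _ /=; rewrite mulr1 ger0_norm.
rewrite (@ge0_poisson_prob_stein (cst 1))//.
have -> : (\int[pois]_k (cst 1%R k.+1)%:E = \int[pois]_k (cst 1 k))%E by [].
rewrite integral_cst// mul1e lte_mul_pinfty ?lee_fin ?ltW//.
by rewrite (le_lt_trans (probability_le1 _ _)) ?ltry.
Qed.

Lemma integrableM_id_poisson_prob (f : nat -> R) (M : R) :
  (forall x, `|f x| <= M) ->
  pois.-integrable setT (fun k => (k%:R * f k)%:E).
Proof.
move=> fM; apply: (integrableMl measurableT integrable_id_poisson_prob) => //.
exact: le_bounded_fun fM.
Qed.

(** Reduction to the nonnegative case: the identity holds for [f + M], with values in [[0, 2 * M]],
    and for the constant [M]; subtracting gives it for [f]. *)
Lemma poisson_prob_stein (f : nat -> R) (M : R) : (forall k, `|f k| <= M) ->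
  \int[pois]_k (k%:R * f k) = lambda * \int[pois]_k (f k.+1).
Proof.
move=> fM.
have M0 : 0 <= M by apply: le_trans (fM 0%N).
have ge0_stein (g : nat -> R) (N : R) : (forall k, 0 <= g k <= N) ->
    \int[pois]_k (k%:R * g k) = lambda * \int[pois]_k (g k.+1).
  move=> gN; rewrite /Rintegral ge0_poisson_prob_stein; last first.
    by move=> k; case/andP: (gN k).
  rewrite fineM//; apply: integrable_fin_num => //.
  apply: (@integrable_bounded_poisson_prob (fun k => g k.+1) N) => k.
  by case/andP : (gN k.+1) => ? ?; rewrite ger0_norm.
have E1 : \int[pois]_k (k%:R * (f k + M)) = lambda * \int[pois]_k (f k.+1 + M).
  apply: (ge0_stein (fun k => f k + M) (M + M)) => k.
  by have := fM k; rewrite ler_norml => /andP[? ?]; apply/andP; split; lra.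
have E2 : \int[pois]_k (k%:R * M) = lambda * \int[pois]_k M.
  by apply: (ge0_stein (fun k => M) M) => k; rewrite M0 lexx.
have iM : pois.-integrable setT (fun k => (k%:R * M)%:E).
  by apply: (@integrableM_id_poisson_prob (cst M) M) => k /=; rewrite ger0_norm.
move: E1; under [in LHS]eq_Rintegral do rewrite mulrDr.
rewrite RintegralD//; last 2 first.
- by apply: (@integrable_bounded_poisson_prob (fun k => f k.+1) M).
- exact: finite_measure_integrable_cst.
rewrite RintegralD//; last exact: integrableM_id_poisson_prob fM.
by rewrite E2 mulrDr => /addIr.
Qed.
End poisson.

(** * Mean value estimates: Taylor remainder and comparison with [cos x ^+ 2] *)

Section calculus.
Context {R : realType}.

Lemma is_derive_bounded_increment (f f1 : R -> R) (L : R) (a b : R) : a <= b ->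
  (forall x : R, is_derive x 1 f (f1 x)) ->
  (forall x, x \in `[a, b] -> f1 x <= L) -> f b - f a <= L * (b - a).
Proof.
move=> ab df fL.
have [|c cab ->] := @MVT_segment R f f1 a b ab (fun x _ => df x).
- by apply: continuous_subspaceT; exact: is_derive_continuous df.
- by rewrite ler_wpM2r ?subr_ge0// fL.
Qed.

Lemma taylor2_le (f f1 f2 : R -> R) (M u d : R) : 0 <= d ->
  (forall x : R, is_derive x 1 f (f1 x)) ->
  (forall x : R, is_derive x 1 f1 (f2 x)) ->
  (forall x, f2 x <= M) ->
  f (u + d) - f u - d * f1 u <= M * d ^+ 2 / 2.
Proof.
move=> d0 df df1 f2M.
(* Up to the constant [f u], this is the Taylor remainder over a step [t] minus the claimed bound.
   The mean value theorem is used twice: on [f1] it gives [g1 <= 0], on [g] it gives [g d <= g 0],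
   which is the claim. *)
pose g (t : R) := (f \o (fun t => u + t)) t - f1 u *: t - (M / 2) *: t ^+ 2.
pose g1 (t : R) := f1 (u + t) - f1 u - M * t.
have dg (t : R) : is_derive t 1 g (g1 t).
  have d1 := df (u + t).
  by apply: is_derive_eq; rewrite /g1 /GRing.scale/=; field.
have := @is_derive_bounded_increment g g1 0 0 d d0 dg.
have g1le t : t \in `[0, d] -> g1 t <= 0.
  rewrite in_itv/= => /andP[t0 _].
  have := @is_derive_bounded_increment f1 f2 M u (u + t) _ df1
    (fun x _ => f2M x).
  by rewrite lerDl => /(_ t0); rewrite /g1; lra.
move=> /(_ g1le); rewrite /g /GRing.scale/= addr0; lra.
Qed.

Lemma taylor2 (f f1 f2 : R -> R) (M u d : R) : 0 <= d ->
  (forall x : R, is_derive x 1 f (f1 x)) ->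
  (forall x : R, is_derive x 1 f1 (f2 x)) ->
  (forall x, `|f2 x| <= M) ->
  `|f (u + d) - f u - d * f1 u| <= M * d ^+ 2 / 2.
Proof.
move=> d0 df df1 f2M; rewrite ler_norml; apply/andP; split; last first.
  by apply: taylor2_le df df1 _ => // x; exact: le_trans (ler_norm _) (f2M x).
suff H : - f (u + d) - - f u - d * - f1 u <= M * d ^+ 2 / 2 by move: H; lra.
apply: (@taylor2_le (\- f) (\- f1) (\- f2)) => // x.
by rewrite (le_trans _ (f2M x))// -normrN ler_norm.
Qed.

(** [p] below is an antiderivative of [cos x ^+ 2] that grows by [pi / 4] over the interval. Instead
    of integrating [f1], the mean value theorem is applied to [f - L * p], and to [- f - L * p] for
    the other sign. *)
Lemma le_cos2_increment (f f1 : R -> R) (L : R) :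
  (forall x : R, is_derive x 1 f (f1 x)) ->
  (forall x, 0 <= x <= pi / 2 -> `|f1 x| <= L * cos x ^+ 2) ->
  `|f (pi / 2) - f 0| <= L * (pi / 4).
Proof.
have pi2 : 0 <= pi / 2 :> R by rewrite divr_ge0// pi_ge0.
pose p (x : R) : R := 2^-1 *: (x + sin x * cos x).
have dp (x : R) : is_derive x 1 p (cos x ^+ 2).
  apply: is_derive_eq; rewrite /GRing.scale/=.
  by have := cos2Dsin2 x; nra.
have pE : p (pi / 2) - p 0 = pi / 4.
  by rewrite /p /GRing.scale/= cos_pihalf sin0; field.
have H (g g1 : R -> R) : (forall x : R, is_derive x 1 g (g1 x)) ->
    (forall x, 0 <= x <= pi / 2 -> g1 x <= L * cos x ^+ 2) ->
    g (pi / 2) - g 0 <= L * (pi / 4).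
  move=> dg gL.
  have := @is_derive_bounded_increment (g \- (L \*: p))
    (fun x => g1 x - L * cos x ^+ 2) 0 0 (pi / 2) pi2.
  rewrite -pE mul0r /= /GRing.scale/=.
  have A : forall x, x \in `[0, pi / 2] -> g1 x - L * cos x ^+ 2 <= 0.
    by move=> x; rewrite in_itv/= => /gL; lra.
  move=> /(_ _ A) B.
  suff : g (pi / 2) - L * p (pi / 2) - (g 0 - L * p 0) <= 0 by lra.
  exact: B.
move=> df fL; rewrite ler_norml; apply/andP; split; last first.
  by apply: H df _ => x /fL; exact: le_trans (ler_norm _).
suff : - f (pi / 2) - - f 0 <= L * (pi / 4) by lra.
apply: (H (\- f) (\- f1)) => x /fL.
by rewrite -normrN; exact: le_trans (ler_norm _).
Qed.

End calculus.

(** * Gaussian averages along the rotation, and their derivatives *)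

Section interpolation.
Context {R : realType}.
Local Notation gauss := (normal_prob (0 : R) 1).
Variables (F F1 F2 : R -> R) (M : R).
Hypothesis dF : forall x : R, is_derive x 1 F (F1 x).
Hypothesis dF1 : forall x : R, is_derive x 1 F1 (F2 x).
Hypothesis FM : forall x, `|F x| <= M.
Hypothesis F1M : forall x, `|F1 x| <= M.
Hypothesis F2M : forall x, `|F2 x| <= M.

Let cF : continuous F := is_derive_continuous _ _ _ dF.
Let cF1 : continuous F1 := is_derive_continuous _ _ _ dF1.
Let M0 : 0 <= M := le_trans (normr_ge0 _) (FM 0).

Let caffine (c s : R) (f : R -> R) :
  continuous f -> continuous (fun y => f (c + s * y)).
Proof.
move=> cf x.
apply: (@continuous_comp _ _ _ (fun y => c + s * y) f); last exact: cf.
apply: continuousD; first exact: cvg_cst.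
by apply: continuousM; [exact: cvg_cst|exact: cvg_id].
Qed.

(** For [t] in [[0, pi / 2)] this is Mehler's formula for the Ornstein-Uhlenbeck semigroup, with
    [cos t] as [exp (- s)]. The weighted variant [rotate1] arises on differentiating in [t]. *)
Definition rotate (t x : R) (f : R -> R) :=
  \int[gauss]_y f (cos t * x + sin t * y).
Definition rotate1 (t x : R) (f : R -> R) :=
  \int[gauss]_y (y * f (cos t * x + sin t * y)).

(** The inner derivative in [y] brings out the factor [sin t]. Trading [F1] for [F] lowers by one
    the order of derivative that the Taylor remainder calls for later. *)
Lemma integral_by_parts_rotate t x : sin t * rotate t x F1 = rotate1 t x F.
Proof.
rewrite /rotate /rotate1 -RintegralZl//; last first.
  apply: (integrable_bounded_normal_prob _ M) => //. exact: caffine.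
apply/esym/(integral_normal_prob_by_parts (fun y => F (cos t * x + sin t * y))
  (fun y => sin t * F1 (cos t * x + sin t * y)) M) => //.
- move=> y.
  have := dF (cos t * x + sin t * y) => d1.
  have d2 : is_derive y 1 (fun y => cos t * x + sin t * y) (sin t).
    have -> : (fun y => cos t * x + sin t * y) =
        cst (cos t * x) + sin t \*: id by [].
    by apply: is_derive_eq; rewrite add0r /GRing.scale/= mulr1.
  rewrite [_ * F1 _]mulrC.
  exact: (@is_derive1_comp R F (fun y => cos t * x + sin t * y) y _ _ d1 d2).
- by move=> y; apply: continuousM; [exact: cvg_cst|exact: caffine].
- move=> y; rewrite normrM -[leRHS]mul1r ler_pM//.
  by rewrite ler_norml sin_geN1 sin_le1.
Qed.

Lemma is_derive_rotate (t x : R) : is_derive t 1 (fun t => rotate t x F)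
  (- sin t * x * rotate t x F1 + cos t * rotate1 t x F1).
Proof.
pose f (s y : R) := F (cos s * x + sin s * y).
have df (s y : R) : is_derive s 1 (fun s => f s y)
    ((- sin s * x + cos s * y) * F1 (cos s * x + sin s * y)).
  have d1 := dF (cos s * x + sin s * y).
  have d2 : is_derive s 1 (fun s => cos s * x + sin s * y)
      (- sin s * x + cos s * y).
    have -> : (fun s => cos s * x + sin s * y) = x \*: cos + y \*: sin.
      by apply/funext => z /=; rewrite mulrC [sin z * _]mulrC.
    by apply: is_derive_eq; rewrite /GRing.scale/= mulrC [y * _]mulrC.
  rewrite [_ * F1 _]mulrC.
  exact: (@is_derive1_comp R F (fun s => cos s * x + sin s * y) s _ _ d1 d2).
pose I := `](t - 1), (t + 1)[%classic.
have tI : I t by rewrite /I/= in_itv/=; apply/andP; split; lra.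
have intf s : I s -> gauss.-integrable setT (EFin \o f s).
  move=> _; apply: (integrable_bounded_normal_prob (f s) M).
    exact: (@caffine _ _ F).
  by move=> y; exact: FM.
have derf s y : I s -> setT y -> derivable (f ^~ y) s 1.
  by move=> _ _; case: (df s y).
(* Dominates the derivative in [s], since sine, cosine and [F1] are bounded; it is integrable
   because the Gaussian has a finite first moment. The bound is uniform in [s], so the width of [I]
   is arbitrary. *)
pose G (y : R) := (`|x| + `|y|) * M.
have iG : gauss.-integrable setT (EFin \o G).
  have -> : EFin \o G = (fun y => (`|x| * M)%:E + M%:E * `|y|%:E)%E.
    by apply/funext => y; rewrite /G /= mulrDl EFinD [(`|y| * M)%R]mulrC.
  apply: integrableD => //.
  - exact: finite_measure_integrable_cst.
  - apply: integrableZl => //.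
    exact: integrable_abse (@integrable_id_normal_prob R).
have G0 y : 0 <= G y by rewrite mulr_ge0// addr_ge0.
have fG s y : I s -> setT y -> `|partial1of2 f s y| <= G y.
  move=> _ _; have := df s y => d1.
  rewrite partial1of2E derive_val normrM ler_pM//.
  rewrite (le_trans (ler_normD _ _))// !normrM normrN lerD// ler_piMl//.
    by rewrite ler_norml sin_geN1 sin_le1.
  by rewrite ler_norml cos_geN1 cos_le1.
have E := differentiation_under_integral measurableT tI intf derf G0 iG fG.
have D := derivable_under_integral measurableT tI intf derf G0 iG fG.
apply: DeriveDef; first exact: D.
rewrite -derive1E; apply: etrans E _.
have iF1 : gauss.-integrable setT
    (EFin \o (fun y => F1 (cos t * x + sin t * y))).
  by apply: (integrable_bounded_normal_prob _ M) => //; exact: caffine.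
have iyF1 : gauss.-integrable setT
    (EFin \o (fun y => y * F1 (cos t * x + sin t * y))).
  by apply: (integrableM_id_normal_prob _ M) => //; exact: caffine.
rewrite /rotate /rotate1 -!RintegralZl// -RintegralD//; last 2 first.
- exact: (integrableZl measurableT _ iF1).
- exact: (integrableZl measurableT _ iyF1).
apply: eq_Rintegral => y _ /=.
have := df t y => d1; rewrite partial1of2E derive_val; ring.
Qed.

Lemma rotate_le t x (f : R -> R) : continuous f -> (forall y, `|f y| <= M) ->
  `|rotate t x f| <= M.
Proof.
move=> cf fM; apply: Rintegral_probability_le => //.
by apply: (integrable_bounded_normal_prob _ M) => //; exact: caffine.
Qed.

Lemma rotate1_le t x (f : R -> R) : continuous f -> (forall y, `|f y| <= M) ->
  `|rotate1 t x f| <= M * Num.sqrt (2 / pi).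
Proof. by move=> cf fM; apply: normal_prob_moment_le => //; exact: caffine. Qed.

(** Integration by parts on both [sin t] terms turns the left side into a single moment of
    [y * g y], where [g] is the Taylor remainder of [F] over the step [cos t * h], nonnegative by
    the hypotheses. *)
Lemma rotate_increment_le t x h : 0 <= h -> 0 <= cos t ->
  `|sin t * (rotate t (x + h) F1 - rotate t x F1) - cos t * h * rotate1 t x F1|
    <= M * (cos t * h) ^+ 2 / 2 * Num.sqrt (2 / pi).
Proof.
move=> h0 c0; have ch0 : 0 <= cos t * h by exact: mulr_ge0.
rewrite mulrBr !integral_by_parts_rotate /rotate1.
have i1 z : gauss.-integrable setT
    (EFin \o (fun y => y * F (cos t * z + sin t * y))).
  by apply: (integrableM_id_normal_prob _ M) => //; exact: caffine.
have i2 : gauss.-integrable setT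
    (EFin \o (fun y => y * F1 (cos t * x + sin t * y))).
  by apply: (integrableM_id_normal_prob _ M) => //; exact: caffine.
have i3 : gauss.-integrable setT
    (EFin \o (fun y => cos t * h * (y * F1 (cos t * x + sin t * y)))).
  exact: (integrableZl measurableT _ i2).
have i12 : gauss.-integrable setT
    (EFin \o (fun y => y * F (cos t * (x + h) + sin t * y) -
      y * F (cos t * x + sin t * y))).
  by have := integrableB measurableT (i1 (x + h)) (i1 x).
rewrite -RintegralZl// -RintegralB// -RintegralB//.
pose g y := F (cos t * x + sin t * y + cos t * h) - F (cos t * x + sin t * y)
  - cos t * h * F1 (cos t * x + sin t * y).
have -> : (fun y => y * F (cos t * (x + h) + sin t * y) -
    y * F (cos t * x + sin t * y) -
    cos t * h * (y * F1 (cos t * x + sin t * y))) = (fun y => y * g y).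
  apply/funext => y; rewrite /g.
  have -> : cos t * (x + h) + sin t * y =
    cos t * x + sin t * y + cos t * h by ring.
  by ring.
apply: normal_prob_moment_le.
- rewrite /g => y; apply: cvgB; last first.
    by apply: cvgM; [exact: cvg_cst|exact: (@caffine _ _ F1)].
  apply: cvgB; last exact: (@caffine _ _ F).
  by under eq_fun do rewrite addrAC; rewrite addrAC; exact: (@caffine _ _ F).
- by move=> y; exact: (taylor2 _ _ _ _ _ _ ch0 dF dF1 F2M).
Qed.

(** * Interpolation between the standardized Poisson variable and the Gaussian *)

Section poisson_normal.
Variables (lambda : R) (lambda_gt0 : 0 < lambda).
Local Notation pois := (poisson_prob lambda 0).
Let h : R := (Num.sqrt lambda)^-1.
Let x (k : nat) : R := (k%:R - lambda) / Num.sqrt lambda.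

(** A unit jump of the Poisson variable moves the standardized one by [h], and centering by [lambda]
    turns the shift of the Stein identity into a difference. The prefactor is
    [h * lambda = sqrt lambda]. *)
Lemma poisson_prob_standardized_stein (f : R -> R) : (forall y, `|f y| <= M) ->
  \int[pois]_k (x k * f (x k)) =
  Num.sqrt lambda * \int[pois]_k (f (x k + h) - f (x k)).
Proof.
move=> fM.
have sl0 : Num.sqrt lambda != 0 by rewrite gt_eqF// sqrtr_gt0.
have xS k : x k.+1 = x k + h by rewrite /x /h -natr1; field.
have fxM k : `|f (x k)| <= M by exact: fM.
have S := poisson_prob_stein _ lambda_gt0 _ _ fxM.
have i1 : pois.-integrable setT (EFin \o (fun k => f (x k))).
  exact: (@integrable_bounded_poisson_prob R lambda _ M).
have i2 : pois.-integrable setT (EFin \o (fun k => f (x k + h))).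
  exact: (@integrable_bounded_poisson_prob R lambda (fun k => f (x k + h)) M).
have i3 := integrableM_id_poisson_prob _ lambda_gt0 _ _ fxM.
have i4 : pois.-integrable setT (EFin \o (fun k => lambda * f (x k))).
  exact: (integrableZl measurableT _ i1).
have i5 : pois.-integrable setT
    (EFin \o (fun k : nat => k%:R * f (x k) - lambda * f (x k))).
  by have := integrableB measurableT i3 i4.
rewrite RintegralB//.
transitivity (\int[pois]_k (h * (k%:R * f (x k) - lambda * f (x k)))).
  by apply: eq_Rintegral => k _; rewrite /h {1}/x; field.
rewrite RintegralZl// RintegralB// S RintegralZl// -mulrBr mulrA; congr (_ * _).
  by rewrite -[lambda in LHS]sqr_sqrtr ?ltW// /h; field.
by congr (_ - _); apply: eq_Rintegral => k _; rewrite xS.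
Qed.

Let phi (t : R) := \int[pois]_k rotate t (x k) F.
Let dphi (t : R) := \int[pois]_k
  (- sin t * x k * rotate t (x k) F1 + cos t * rotate1 t (x k) F1).

Lemma integrable_standardized_poisson : pois.-integrable setT (EFin \o x).
Proof.
have i1 := @integrable_id_poisson_prob R lambda lambda_gt0.
have i2 : pois.-integrable setT (EFin \o cst lambda).
  exact: finite_measure_integrable_cst.
by have := integrableZr measurableT (Num.sqrt lambda)^-1
  (integrableB measurableT i1 i2).
Qed.

Lemma is_derive_poisson_rotate (t : R) : is_derive t 1 phi (dphi t).
Proof.
pose f (s : R) k := rotate s (x k) F.
pose I := `](t - 1), (t + 1)[%classic.
have tI : I t by rewrite /I/= in_itv/=; apply/andP; split; lra.
have intf s : I s -> pois.-integrable setT (EFin \o f s).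
  move=> _; apply: (@integrable_bounded_poisson_prob R lambda _ M) => k.
  exact: rotate_le.
have derf s k : I s -> setT k -> derivable (f ^~ k) s 1.
  by move=> _ _; case: (is_derive_rotate s (x k)).
(* The two summands dominate the [rotate] and [rotate1] terms of the derivative; integrability comes
   from the finite Poisson mean. *)
pose G k := (`|x k| + Num.sqrt (2 / pi)) * M.
have iG : pois.-integrable setT (EFin \o G).
  have -> : EFin \o G =
      (fun k => M%:E * `|x k|%:E + (Num.sqrt (2 / pi) * M)%:E)%E.
    by apply/funext => y; rewrite /G /= mulrDl EFinD mulrC.
  apply: integrableD => //; last exact: finite_measure_integrable_cst.
  apply: integrableZl => //.
  exact: integrable_abse integrable_standardized_poisson.
have G0 y : 0 <= G y by rewrite mulr_ge0// addr_ge0// sqrtr_ge0.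
have fG s k : I s -> setT k -> `|partial1of2 f s k| <= G k.
  move=> _ _; have := is_derive_rotate s (x k) => d1.
  rewrite partial1of2E derive_val.
  rewrite (le_trans (ler_normD _ _))// /G mulrDl lerD//.
    rewrite normrM ler_pM ?rotate_le// normrM normrN ler_piMl//.
    by rewrite ler_norml sin_geN1 sin_le1.
  rewrite normrM mulrC [leRHS]mulrC -[leRHS]mulr1 ler_pM ?rotate1_le//.
  by rewrite ler_norml cos_geN1 cos_le1.
have E := differentiation_under_integral measurableT tI intf derf G0 iG fG.
have D := derivable_under_integral measurableT tI intf derf G0 iG fG.
apply: DeriveDef; first exact: D.
rewrite -derive1E; apply: etrans E _.
apply: eq_Rintegral => k _.
by have := is_derive_rotate t (x k) => d1; rewrite partial1of2E derive_val.
Qed.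

Lemma poisson_rotate_derive_le t : 0 <= cos t ->
  `|dphi t| <= M * h / 2 * Num.sqrt (2 / pi) * cos t ^+ 2.
Proof.
move=> c0.
have sl0 : Num.sqrt lambda != 0 by rewrite gt_eqF// sqrtr_gt0.
have h0 : 0 <= h by rewrite invr_ge0 sqrtr_ge0.
have slh : Num.sqrt lambda * h = 1 by rewrite /h divff.
pose A y := rotate t y F1.
pose C y := rotate1 t y F1.
have AM y : `|A y| <= M by exact: rotate_le.
have CM y : `|C y| <= M * Num.sqrt (2 / pi) by exact: rotate1_le.
have iA : pois.-integrable setT (EFin \o (fun k => A (x k))).
  by apply: (@integrable_bounded_poisson_prob R lambda _ M) => k; exact: AM.
have iAh : pois.-integrable setT (EFin \o (fun k => A (x k + h))).
  by apply: (@integrable_bounded_poisson_prob R lambda _ M) => k; exact: AM.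
have iC : pois.-integrable setT (EFin \o (fun k => C (x k))).
  apply: (@integrable_bounded_poisson_prob R lambda _ (M * Num.sqrt (2 / pi))).
  by move=> k; exact: CM.
have iAA : pois.-integrable setT (EFin \o (fun k => A (x k + h) - A (x k))).
  by have := integrableB measurableT iAh iA.
have ixA : pois.-integrable setT (EFin \o (fun k => x k * A (x k))).
  apply: (integrableMl measurableT integrable_standardized_poisson) => //.
  by apply: (le_bounded_fun _ _ _ M) => k; exact: AM.
pose D k := sin t * (A (x k + h) - A (x k)) - cos t * h * C (x k).
have iD1 : pois.-integrable setT
    (EFin \o (fun k => sin t * (A (x k + h) - A (x k)))).
  exact: (integrableZl measurableT _ iAA).
have iD2 : pois.-integrable setT (EFin \o (fun k => cos t * h * C (x k))).
  exact: (integrableZl measurableT _ iC).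
have iD : pois.-integrable setT (EFin \o D).
  by have := integrableB measurableT iD1 iD2.
(* The Stein identity for [A] turns [x k * A (x k)] into an increment; inserting
   [1 = sqrt lambda * h] before the [rotate1] term lets [- sqrt lambda] factor out. *)
have -> : dphi t = - Num.sqrt lambda * \int[pois]_k D k.
  rewrite /dphi.
  have -> : (fun k => - sin t * x k * rotate t (x k) F1 +
      cos t * rotate1 t (x k) F1) =
      (fun k => - sin t * (x k * A (x k)) + cos t * C (x k)).
    by apply/funext => k; rewrite /A /C -!mulrA.
  rewrite RintegralD//; last 2 first.
  - exact: (integrableZl measurableT _ ixA).
  - exact: (integrableZl measurableT _ iC).
  have -> : \int[pois]_k D k =
      sin t * \int[pois]_k (A (x k + h) - A (x k)) -
      cos t * h * \int[pois]_k C (x k).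
    by rewrite RintegralB// RintegralZl// RintegralZl.
  rewrite !RintegralZl// (poisson_prob_standardized_stein A AM).
  move: slh; set l := Num.sqrt lambda => slh.
  set IA := \int[_]_k _; set IC := \int[_]_k C _.
  have -> : cos t * IC = l * h * (cos t * IC) by rewrite slh mul1r.
  by ring.
rewrite normrM normrN (ger0_norm (sqrtr_ge0 _)).
apply: (@le_trans _ _ (Num.sqrt lambda *
    (M * (cos t * h) ^+ 2 / 2 * Num.sqrt (2 / pi)))).
  rewrite ler_wpM2l ?sqrtr_ge0//; apply: Rintegral_probability_le => // k.
  exact: rotate_increment_le.
(* The bound on [D] is quadratic in [h]; the prefactor [sqrt lambda] absorbs one power and leaves
   the rate [h]. *)
have -> : Num.sqrt lambda * (M * (cos t * h) ^+ 2 / 2 * Num.sqrt (2 / pi)) =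
    (Num.sqrt lambda * h) * (M * h / 2 * Num.sqrt (2 / pi) * cos t ^+ 2).
  by field.
by rewrite slh mul1r.
Qed.

Lemma poisson_normal_interpolation_le :
  `|\int[pois]_k F (x k) - \int[gauss]_y F y|
    <= M * (Num.sqrt pi / (4 * Num.sqrt 2)) * h.
Proof.
(* At each endpoint the rotation forgets one of the two variables, and integrating a constant
   against a probability returns it. *)
have E0 : phi 0 = \int[pois]_k F (x k).
  apply: eq_Rintegral => k _.
  rewrite /rotate -[RHS](@Rintegral_probability_cst _ _ _ gauss).
  by apply: eq_Rintegral => y _; rewrite cos0 sin0 mul1r mul0r addr0.
have E1 : phi (pi / 2) = \int[gauss]_y F y.
  rewrite -[RHS](@Rintegral_probability_cst _ _ _ pois).
  apply: eq_Rintegral => k _; rewrite /rotate.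
  apply: eq_Rintegral => y _.
  by rewrite cos_pihalf sin_pihalf mul1r mul0r add0r.
rewrite -E0 -E1 distrC.
have := @le_cos2_increment R phi dphi (M * h / 2 * Num.sqrt (2 / pi))
  is_derive_poisson_rotate.
have H z : 0 <= z <= pi / 2 ->
    `|dphi z| <= M * h / 2 * Num.sqrt (2 / pi) * cos z ^+ 2.
  move=> /andP[z0 z1]; apply: poisson_rotate_derive_le; apply: cos_ge0_pihalf.
  by rewrite z1 andbT (le_trans _ z0)// oppr_le0 divr_ge0// pi_ge0.
move=> /(_ H) /le_trans; apply.
(* The constant is [1 / 2 * sqrt (2 / pi) * (pi / 4) = sqrt (2 pi) / 8 = sqrt pi / (4 * sqrt 2)]. *)
have s2 : Num.sqrt 2 ^+ 2 = 2 :> R by rewrite sqr_sqrtr.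
have sp : Num.sqrt pi ^+ 2 = pi :> R by rewrite sqr_sqrtr// pi_ge0.
have s20 : Num.sqrt 2 != 0 :> R by rewrite gt_eqF// sqrtr_gt0.
have sp0 : Num.sqrt pi != 0 :> R by rewrite gt_eqF// sqrtr_gt0 pi_gt0.
have -> : pi / 4 = Num.sqrt pi ^+ 2 / 4 :> R by rewrite sp.
rewrite sqrtrM// sqrtrV ?pi_ge0//.
move: (Num.sqrt 2) (Num.sqrt pi) s2 s20 sp0 {sp} => a p a2 a0 p0.
rewrite le_eqVlt; apply/orP; left; apply/eqP.
have -> : M * h / 2 * (a / p) * (p ^+ 2 / 4) = M * h * p * a / 8 by field.
have -> : M * (p / (4 * a)) * h = M * h * p * a * (4 * a ^+ 2)^-1 by field.
by rewrite a2; field.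
Qed.
End poisson_normal.
End interpolation.

(** * From norms and random variables to the interpolation bound *)

Lemma sup_norm_ge (R : realType) (f : R -> R) (x : R) :
  (`|f x|%:E <= sup_norm f)%E.
Proof. by apply: ereal_sup_ubound => /=; exists x. Qed.

Lemma sup_norm_ge0 (R : realType) (f : R -> R) : (0 <= sup_norm f)%E.
Proof. by apply: le_trans (sup_norm_ge _ f 0); rewrite lee_fin. Qed.

(** The three sup norms are nonnegative in [\bar R], so each is at most their sum. *)
Lemma C2b_norm_le (R : realType) (F : R -> R) (M : R) :
  (C2b_norm F <= M%:E)%E ->
  forall x,
    [/\ `|F x| <= M, `|F^`()%classic x| <= M & `|F^`(2)%classic x| <= M].
Proof.
rewrite /C2b_norm => FM x; have s0 f := sup_norm_ge0 R f.
split; rewrite -lee_fin; apply: le_trans (sup_norm_ge _ _ _) (le_trans _ FM).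
- by rewrite -addeA leeDl// adde_ge0.
- by rewrite -addeA addeCA leeDl// adde_ge0.
- by rewrite leeDr// adde_ge0.
Qed.

(** The expectation is an integral against the law of [Z], which [is_poisson] identifies set by set;
    the bound [M] supplies integrability. *)
Lemma integral_is_poisson (R : realType) d (T : measurableType d)
    (P : probability T R) (lambda : R) (Z : {RV P >-> nat})
    (f : nat -> R) (M : R) :
  is_poisson lambda Z -> (forall k, `|f k| <= M) ->
  ('E_P[fun w => f (Z w)] = \int[poisson_prob lambda 0]_k (f k)%:E)%E.
Proof.
move=> Zp fM; rewrite unlock.
rewrite (_ : \int[P]_w _ = \int[P]_w ((EFin \o f) \o Z) w)%E//.
have mfZ : measurable_fun [set: T] (f \o Z) by apply: measurableT_comp.
rewrite -integral_distribution//.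
- by apply: eq_measure_integral => A _ _; exact: Zp.
- exact: (@integrable_bounded_probability _ _ _ P _ M).
Qed.

Theorem mainTheorem1 (R : realType) (d : measure_display) (T : measurableType d)
    (P : probability T R) (lambda : R) (lambda_gt0 : 0 < lambda)
    (Z : {RV P >-> nat}) (Z_poisson : is_poisson lambda Z) :
  (ereal_sup [set `| 'E_P[fun w => F (((Z w)%:R - lambda) / Num.sqrt lambda)%R] -
                     \int[normal_prob (0 : R) 1]_x (F x)%:E |
               | F in [set F : R -> R | C2b F /\ (C2b_norm F <= 1)%E] ]
   <= (Num.sqrt pi / (4 * Num.sqrt 2) * (1 / Num.sqrt lambda))%:E)%E.

Proof.
apply: ge_ereal_sup => _ [F [[dF dF1 _ _] F1] <-].
have FM := C2b_norm_le R F 1 F1.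
have dF' (x : R) : is_derive x 1 F (F^`()%classic x).
  by rewrite derive1E; exact/derivableP/dF.
have dF1' (x : R) : is_derive x 1 F^`()%classic (F^`(2)%classic x).
  by rewrite derive1nS derive1E; exact/derivableP/dF1.
have FM0 x : `|F x| <= 1 by case: (FM x).
have cF : continuous F := is_derive_continuous _ _ _ dF'.
pose x (k : nat) : R := (k%:R - lambda) / Num.sqrt lambda.
have iF : (poisson_prob lambda 0).-integrable setT (EFin \o (F \o x)).
  apply: (integrable_bounded_poisson_prob lambda (F \o x) 1) => k.
  exact: FM0.
have iG := integrable_bounded_normal_prob F 1 cF FM0.
rewrite (integral_is_poisson _ _ _ _ _ _ (F \o x) 1 Z_poisson); last first.
  by move=> k; exact: FM0.
have FM1 y : `|F^`()%classic y| <= 1 by case: (FM y).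
have FM2 y : `|F^`(2)%classic y| <= 1 by case: (FM y).
have := @poisson_normal_interpolation_le R F _ _ 1 dF' dF1' FM0 FM1 FM2
  lambda lambda_gt0.
(* Both integrals are finite, so the difference in [\bar R] reduces to the real one bounded by
   interpolation with [M = 1]. *)
rewrite mul1r -(fineK (integrable_fin_num measurableT iF)).
rewrite -(fineK (integrable_fin_num measurableT iG)) -EFinB /= lee_fin.
by rewrite div1r.
Qed.
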